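(* Let $n\ge 2$ and let $(a,\beta,A,\eta)\in\mathbb{R}\times\mathfrak{k}_1^*\times\mathfrak{gl}(\mathfrak{k}_1)\times\Lambda^2\mathfrak{k}_1^*$ with $\eta\neq 0$ and $A^*\eta=a\eta$. The almost-Hermitian Lie algebra $(\mu(a,\beta,A,\eta),J,g)$ is Hermitian, i.e. $J$ is integrable, if and only if $$[A,J|_{\mathfrak{k}_1}]=0,\qquad \beta=0,\qquad \eta\in\Lambda^{1,1}\mathfrak{k}_1^*.$$
   Context: On $\mathbb{R}^{2n}$ with standard basis $\{e_1,\dots,e_{2n}\}$ let $g=\sum_{l=1}^{2n}(e^l)^2$ be the standard inner product, let $J$ be the almost complex structure with $Je_1=e_{2n}$, $Je_{2l}=e_{2l+1}$ for $l=1,\dots,n-1$, and let $\mathfrak{k}_1=\mathbb{R}\langle e_2,\dots,e_{2n-1}\rangle$. For $A\in\mathfrak{gl}(\mathfrak{k}_1)$ and a 2-form $\sigma$ on $\mathfrak{k}_1$, $(A^*\sigma)(X,Y)=\sigma(AX,Y)+\sigma(X,AY)$. For $a\in\mathbb{R}$, $\beta\in\mathfrak{k}_1^*$, $A\in\mathfrak{gl}(\mathfrak{k}_1)$, $0\ne\eta\in\Lambda^2\mathfrak{k}_1^*$ with $A^*\eta=a\eta$, $\mu(a,\beta,A,\eta)$ denotes the Lie algebra structure on $\mathbb{R}^{2n}$ with brackets $[e_{2n},e_1]=a e_1$, $[e_{2n},X]=\beta(X)e_1+AX$, $[X,Y]=-\eta(X,Y)e_1$, $[e_1,X]=0$ for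 $X,Y\in\mathfrak{k}_1$ (the condition $A^*\eta=a\eta$ is equivalent to the Jacobi identity). $J$ is integrable if its Nijenhuis tensor $N(X,Y)=[JX,JY]-J[JX,Y]-J[X,JY]-[X,Y]$ vanishes. $\Lambda^{1,1}\mathfrak{k}_1^*$ is the space of (real) 2-forms $\eta$ on $\mathfrak{k}_1$ with $\eta(JX,JY)=\eta(X,Y)$. *)

(* Defs.v *)
From HB Require Import structures.
From mathcomp Require Import all_boot all_order all_algebra.
From mathcomp Require Export reals.
From mathcomp Require Import zify ring.

Set Implicit Arguments.
Unset Strict Implicit.
Unset Printing Implicit Defensive.

Import Order.TTheory GRing.Theory Num.Theory.
Local Open Scope ring_scope.

Section AlmostHermitian.
Variable R : realFieldType.

Record lieBracket (V : lmodType R) := LieBracket {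
  bracket :> V -> V -> V;
  bracket_linearl : forall y, linear (bracket^~ y);
  bracket_linearr : forall x, linear (bracket x);
  bracket_alternating : forall x, bracket x x = 0;
  bracket_jacobi : forall x y z,
    bracket x (bracket y z) + bracket y (bracket z x)
      + bracket z (bracket x y) = 0 }.

Record almostHermitianLie (V : vectType R) := AlmostHermitianLie {
  ah_bracket : lieBracket V;
  ah_J : 'End(V);
  ah_metric : {dot V for idfun};
  ah_J_sqr : forall x, ah_J (ah_J x) = - x;
  ah_compat : forall x y, ah_metric (ah_J x) (ah_J y) = ah_metric x y }.

Definition nijenhuis (V : vectType R) (br : lieBracket V) (J : 'End(V))
    (x y : V) : V :=
  br (J x) (J y) - J (br (J x) y) - J (br x (J y)) - br x y.

Definition integrable (V : vectType R) (br : lieBracket V) (J : 'End(V)) :=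
  forall x y, nijenhuis br J x y = 0.

Definition is_hermitian (V : vectType R) (h : almostHermitianLie V) :=
  integrable (ah_bracket h) (ah_J h).

(* [A^* sigma], the derivation induced by [A], not the pullback. *)
Definition derived_form (U : vectType R) (A : 'End(U)) (s : U -> U -> R)
    (x y : U) : R :=
  s (A x) y + s x (A y).

(* [s] lies in [Lambda^{1,1}]. *)
Definition type11 (U : vectType R) (J : 'End(U)) (s : {skew_symmetric U}) :=
  forall x y, s (J x) (J y) = s x y.

End AlmostHermitian.

Section Standard.
Variables (R : realFieldType) (n : nat).

Notation Vst := 'rV[R]_(2 * n).

(* Indices of the basis run from 1 to 2n, whereas those of a row vector run
   from 0 to 2n - 1; out of range, [e l] and its dual [ed l] are 0. *)
Definition e (l : nat) : Vst := \row_(j < 2 * n) (j.+1 == l)%:R.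

Definition ed (l : nat) (x : Vst) : R :=
  \sum_(j < 2 * n | j.+1 == l) x 0 j.

Definition gst (x y : Vst) : R :=
  \sum_(1 <= l < (2 * n).+1) ed l x * ed l y.

(* [J (e l)]: the values for [l] odd, [1 < l], and for [l = 2n] are those that
   [J^2 = -1] forces from [J e_1 = e_2n] and [J e_2l = e_(2l+1)]. *)
Definition Je (l : nat) : Vst :=
  if l == 1%N then e (2 * n)
  else if l == (2 * n)%N then - e 1
  else if odd l then - e l.-1
  else e l.+1.

Definition Jfun (x : Vst) : Vst :=
  \sum_(1 <= l < (2 * n).+1) ed l x *: Je l.

Lemma ed_is_linear l : linear_for *%R (ed l).
Proof.
move=> a x y; rewrite /ed mulr_sumr -big_split /=.
by apply: eq_bigr => j _; rewrite !mxE.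
Qed.
HB.instance Definition _ l :=
  GRing.isLinear.Build R Vst R *%R (ed l) (ed_is_linear l).

Lemma Jfun_is_linear : linear Jfun.
Proof.
move=> a x y; rewrite /Jfun scaler_sumr -big_split /=.
by apply: eq_bigr => l _; rewrite linearP scalerDl scalerA.
Qed.
HB.instance Definition _ :=
  GRing.isLinear.Build R Vst Vst *:%R Jfun Jfun_is_linear.

Definition Jst : 'End(Vst) := linfun Jfun.

Definition k1 : {vspace Vst} := <<[seq e l | l <- iota 2 (2 * n - 2)]>>.

Notation k1T := (subvs_of k1).

(* The restriction of [Jst] to [k1]; that [Jst] preserves [k1] is [Jst_k1]. *)
Definition Jk1 : 'End(k1T) := linfun (vsproj k1 \o Jst \o vsval).

Lemma ed_out l x : ~~ (1 <= l < (2 * n).+1)%N -> ed l x = 0.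
Proof.
move=> hl; rewrite /ed big1 // => j /eqP hj; case/negP: hl.
by rewrite -hj; exact: ltn_ord.
Qed.

Lemma ed_ord (j : 'I_(2 * n)) x : ed j.+1 x = x 0 j.
Proof.
rewrite /ed (bigD1 j) //= big1 ?addr0 // => i /andP[/eqP[hij] /negP[]].
by apply/eqP/val_inj.
Qed.

Lemma ed_inj x y : (forall l, ed l x = ed l y) -> x = y.
Proof. by move=> h; apply/rowP => j; rewrite -!ed_ord. Qed.

Lemma ed_e l m : (1 <= l < (2 * n).+1)%N -> ed l (e m) = (l == m)%:R.
Proof.
by case: l => // l /= hl; have := ed_ord (Ordinal (hl : (l < 2 * n)%N)) (e m); rewrite mxE.
Qed.

Lemma e_sum x : x = \sum_(1 <= l < (2 * n).+1) ed l x *: e l.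
Proof.
apply: ed_inj => m; case hm: (1 <= m < (2 * n).+1)%N; last first.
  by rewrite !ed_out ?hm.
rewrite linear_sum /= (bigD1_seq m) ?iota_uniq ?mem_index_iota //=.
rewrite linearZ /= ed_e // eqxx mulr1 big1 ?addr0 // => l /negPf hlm.
by rewrite linearZ /= ed_e // eq_sym hlm mulr0.
Qed.

Lemma Jst_e l : (1 <= l < (2 * n).+1)%N -> Jst (e l) = Je l.
Proof.
move=> hl; rewrite lfunE /= /Jfun (bigD1_seq l) ?iota_uniq ?mem_index_iota //=.
rewrite ed_e // eqxx scale1r big_seq_cond big1 ?addr0 // => m.
by rewrite mem_index_iota => /andP[hm /negPf hlm]; rewrite ed_e // hlm scale0r.
Qed.

Lemma Jst_e1 : (0 < n)%N -> Jst (e 1) = e (2 * n).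
Proof. by move=> hn; rewrite Jst_e //= ltnS muln_gt0. Qed.

Lemma Jst_even l : (1 <= l <= n.-1)%N -> Jst (e (2 * l)) = e (2 * l).+1.
Proof.
move=> /andP[l0 ln]; have {ln} ln: (l < n)%N.
  by case: n ln => [|k]; rewrite ?ltnS //= leqNgt l0.
rewrite Jst_e; last by rewrite muln_gt0 l0 /= ltnS leq_mul2l ltnW.
rewrite /Je; case: eqP => [h|_]; first by have := congr1 odd h; rewrite oddM.
by rewrite eqn_mul2l /= ltn_eqF // oddM.
Qed.

Lemma Jst_sqr x : Jst (Jst x) = - x.
Proof.
rewrite {1}(e_sum x) 2!linear_sum /= {2}(e_sum x) -sumrN.
rewrite !big_seq; apply: eq_bigr => l; rewrite mem_index_iota => hl.
rewrite !linearZ /=; congr (_ *: _); rewrite Jst_e // /Je.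
have n0 : (0 < n)%N by case: n hl => //; case: l.
have n1 : (2 * n != 1)%N by apply/eqP => /(congr1 odd); rewrite oddM.
have hn : (1 <= 2 * n < (2 * n).+1)%N by rewrite muln_gt0 n0 /=.
case: (l =P 1%N) => [->|/eqP l1]; first by rewrite Jst_e // /Je (negPf n1) eqxx.
case: (l =P (2 * n)%N) => [->|/eqP l2n]; first by rewrite linearN /= Jst_e1.
case/andP: hl => l0; rewrite ltnS => l2.
case: (boolP (odd l)) => ol.
  have hl1 : (1 <= l.-1 < (2 * n).+1)%N.
    by case: l l0 l1 l2 {l2n ol} => [|[|l]] //= _ _; rewrite ltnS => /ltnW.
  rewrite linearN /= Jst_e // /Je; case: eqP => [h|_].
    by move: ol; rewrite -(prednK l0) h.
  rewrite ltn_eqF; last by rewrite (leq_trans _ l2) // prednK.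
  have -> : odd l.-1 = false by move: ol; rewrite -{1}(prednK l0) /= => /negPf.
  by rewrite prednK.
rewrite Jst_e; last by rewrite ltnS /= ltn_neqAle l2n.
rewrite /Je eqSS (gtn_eqF l0) /= ol; case: eqP => // h.
by move: ol; rewrite -[odd l]negbK -[~~ odd l]/(odd l.+1) h oddM.
Qed.

Lemma gst_bilinear : bilinear_for *%R (idfun \; *%R) gst.
Proof.
split=> z a x y /=; rewrite /gst mulr_sumr -big_split /=;
  apply: eq_bigr => l _; rewrite linearP /=; first by rewrite mulrDl mulrA.
by rewrite mulrDr mulrCA.
Qed.

Lemma gst_sym x y : gst x y = (-1) ^+ false * idfun (gst y x).
Proof. by rewrite mul1r; apply: eq_bigr => l _; rewrite mulrC. Qed.

Lemma gst_gt0 x : x != 0 -> 0 < gst x x.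
Proof.
move=> x0; have g0 : 0 <= gst x x by apply: sumr_ge0 => l _; rewrite -expr2 sqr_ge0.
rewrite lt_neqAle g0 andbT eq_sym; apply: contra x0 => /eqP gx0.
apply/eqP/ed_inj => l; rewrite linear0.
case hl: (1 <= l < (2 * n).+1)%N; last by rewrite ed_out ?hl.
apply/eqP; rewrite -sqrf_eq0 expr2.
move/eqP: gx0; rewrite psumr_eq0 => [/allP/(_ l)|m _]; last first.
  by rewrite -expr2 sqr_ge0.
by rewrite mem_index_iota hl; apply.
Qed.

HB.instance Definition _ :=
  bilinear_isBilinear.Build R Vst Vst R *%R (idfun \; *%R) gst gst_bilinear.
HB.instance Definition _ :=
  isHermitianSesquilinear.Build R Vst false idfun gst gst_sym.
HB.instance Definition _ := isDotProduct.Build R Vst gst gst_gt0.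

Lemma gst_e x l : gst x (e l) = ed l x.
Proof.
case hl: (1 <= l < (2 * n).+1)%N; last first.
  rewrite ed_out ?hl // /gst big_seq_cond big1 // => m.
  rewrite mem_index_iota andbT => hm; rewrite ed_e //.
  by case: eqP => [ml|]; [rewrite ml hl in hm | rewrite mulr0].
rewrite /gst (bigD1_seq l) ?iota_uniq ?mem_index_iota //= ed_e // eqxx mulr1.
rewrite big_seq_cond big1 ?addr0 // => m.
by rewrite mem_index_iota => /andP[hm /negPf hml]; rewrite ed_e // hml mulr0.
Qed.

(* [Jst] is skew for [gst], whence orthogonal. *)
Lemma ed_Je l m : (1 <= l < (2 * n).+1)%N -> (1 <= m < (2 * n).+1)%N ->
  ed m (Je l) = - ed l (Je m).
Proof.
move=> hl hm; rewrite /Je.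
repeat case: ifPn => ?; rewrite ?linearN /= !ed_e //;
  repeat case: eqP => ? /=; rewrite ?opprK ?oppr0 //; exfalso; lia.
Qed.

Lemma gst_Jl x y : gst (Jst x) y = - gst x (Jst y).
Proof.
rewrite /gst !lfunE /= /Jfun.
under eq_bigr do rewrite linear_sum mulr_suml /=.
under [in RHS]eq_bigr do rewrite linear_sum mulr_sumr /=.
rewrite exchange_big /= -sumrN !big_seq; apply: eq_bigr => l.
rewrite mem_index_iota -sumrN !big_seq => hl; apply: eq_bigr => m.
by rewrite mem_index_iota => hm; rewrite !linearZ /= ed_Je //; ring.
Qed.

Lemma gst_J x y : gst (Jst x) (Jst y) = gst x y.
Proof. by rewrite gst_Jl Jst_sqr linearNr opprK. Qed.

Lemma e_k1 l : (1 < l < 2 * n)%N -> e l \in k1.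
Proof. by move=> hl; apply/memv_span/map_f; rewrite mem_iota; lia. Qed.

Lemma mem_k1 x : (x \in k1) = (ed 1 x == 0) && (ed (2 * n) x == 0).
Proof.
apply/idP/idP => [|/andP[/eqP x1 /eqP xn]]; last first.
  rewrite [x]e_sum big_seq; apply: rpred_sum => l; rewrite mem_index_iota => hl.
  case: (l =P 1%N) => [->|l1]; first by rewrite x1 scale0r mem0v.
  case: (l =P (2 * n)%N) => [->|ln]; first by rewrite xn scale0r mem0v.
  by apply/rpredZ/e_k1; lia.
have ker l : (l == 1%N) || (l == (2 * n)%N) -> x \in k1 -> ed l x == 0.
  move=> hl; have /subvP sk : (k1 <= lker (linfun (ed l : Vst -> R^o)))%VS.
    apply/span_subvP => _ /mapP[m + ->]; rewrite mem_iota memv_ker lfunE /=.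
    move=> hm; rewrite ed_e; last lia.
    by case: (l =P m) => // ?; exfalso; lia.
  by move=> /sk; rewrite memv_ker lfunE.
by move=> xk; rewrite !ker ?eqxx ?orbT.
Qed.

Lemma Jst_k1 x : x \in k1 -> Jst x \in k1.
Proof.
have sub : (k1 <= Jst @^-1: k1)%VS.
  apply/span_subvP => _ /mapP[m + ->]; rewrite mem_iota -memv_preim => hm.
  rewrite Jst_e; last lia.
  rewrite /Je; do ![case: ifPn => ?]; rewrite ?rpredN ?e_k1 //; lia.
by move=> /(subvP sub); rewrite -memv_preim.
Qed.

Lemma Jk1E (X : k1T) : vsval (Jk1 X) = Jst (vsval X).
Proof. by rewrite lfunE /= vsprojK // Jst_k1 ?subvsP. Qed.

(* The component along [k1], in the decomposition of the whole space as the
   sum of the lines of [e 1] and [e (2n)] and of [k1]. *)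
Definition k1_part (x : Vst) : k1T :=
  vsproj k1 (x - ed 1 x *: e 1 - ed (2 * n) x *: e (2 * n)).

Lemma k1_part_is_linear : linear k1_part.
Proof.
move=> c x y; rewrite /k1_part -linearP; congr (vsproj _ _).
by apply: ed_inj => l; rewrite !(linearB, linearD, linearZ) /=; ring.
Qed.
HB.instance Definition _ :=
  GRing.isLinear.Build R Vst k1T *:%R k1_part k1_part_is_linear.

Lemma k1_partE x : (0 < n)%N ->
  x = ed 1 x *: e 1 + vsval (k1_part x) + ed (2 * n) x *: e (2 * n).
Proof.
move=> n0; rewrite vsprojK.
  by apply: ed_inj => l; rewrite !(linearB, linearD, linearZ) /=; ring.
rewrite mem_k1 !(linearB, linearD, linearZ) /= !ed_e ?eqxx; try lia.
have /negPf h : (1 != 2 * n)%N by lia.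
by rewrite [(2 * n == 1)%N]eq_sym h /= !(mulr1, mulr0) !subr0 !subrr eqxx.
Qed.

Lemma k1_part_e1 : (0 < n)%N -> k1_part (e 1) = 0.
Proof.
move=> n0; rewrite /k1_part !ed_e; try lia.
by rewrite (_ : (2 * n == 1)%N = false) ?scale0r ?scale1r ?subr0 ?subrr ?linear0 //; lia.
Qed.

Lemma k1_part_e2n : (0 < n)%N -> k1_part (e (2 * n)) = 0.
Proof.
move=> n0; rewrite /k1_part !ed_e ?eqxx; try lia.
by rewrite (_ : (1 == 2 * n)%N = false) ?scale0r ?scale1r ?subr0 ?subrr ?linear0 //; lia.
Qed.

Lemma ed1_k1 (X : k1T) : ed 1 (vsval X) = 0.
Proof. by have := subvsP X; rewrite mem_k1 => /andP[/eqP]. Qed.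

Lemma ed2n_k1 (X : k1T) : ed (2 * n) (vsval X) = 0.
Proof. by have := subvsP X; rewrite mem_k1 => /andP[_ /eqP]. Qed.

Lemma k1_part_k1 (X : k1T) : k1_part (vsval X) = X.
Proof. by rewrite /k1_part ed1_k1 ed2n_k1 !scale0r !subr0 vsvalK. Qed.

Variables (a : R) (beta : 'Hom(k1T, R^o)) (A : 'End(k1T)).
Variable eta : {skew_symmetric k1T}.

(* The bilinear extension of the brackets of basis elements, which are
   recovered in [mu_e2n_e1], [mu_e2n_k1], [mu_k1_k1] and [mu_e1_k1]. *)
Definition mu_coef (x y : Vst) : R :=
  a * (ed (2 * n) x * ed 1 y - ed 1 x * ed (2 * n) y)
  + ed (2 * n) x * beta (k1_part y) - ed (2 * n) y * beta (k1_part x)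
  - eta (k1_part x) (k1_part y).

Definition mu_fun (x y : Vst) : Vst :=
  mu_coef x y *: e 1
  + vsval (ed (2 * n) x *: A (k1_part y) - ed (2 * n) y *: A (k1_part x)).

Lemma eta_skew X Y : eta X Y = - eta Y X.
Proof. by rewrite hermitian_subproof expr1 mulN1r. Qed.

Let edD l (u v : Vst) : ed l (u + v) = ed l u + ed l v.
Proof. by rewrite linearD. Qed.
Let edN l (u : Vst) : ed l (- u) = - ed l u.
Proof. by rewrite linearN. Qed.
Let edZ l c (u : Vst) : ed l (c *: u) = c * ed l u.
Proof. by rewrite linearZ. Qed.
Let vsD (X Y : k1T) : vsval (X + Y) = vsval X + vsval Y. Proof. by []. Qed.
Let vsN (X : k1T) : vsval (- X) = - vsval X. Proof. by []. Qed.
Let vsZ c (X : k1T) : vsval (c *: X) = c *: vsval X. Proof. by []. Qed.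
Let bD (X Y : k1T) : beta (X + Y) = beta X + beta Y :> R.
Proof. by rewrite linearD. Qed.
Let bN (X : k1T) : beta (- X) = - beta X :> R.
Proof. by rewrite linearN. Qed.
Let bZ c (X : k1T) : beta (c *: X) = c * beta X :> R.
Proof. by rewrite linearZ. Qed.
Let AD (X Y : k1T) : A (X + Y) = A X + A Y. Proof. by rewrite linearD. Qed.
Let AN (X : k1T) : A (- X) = - A X. Proof. by rewrite linearN. Qed.
Let AZ c (X : k1T) : A (c *: X) = c *: A X. Proof. by rewrite linearZ. Qed.
Let hD (X Y Z : k1T) : eta X (Y + Z) = eta X Y + eta X Z.
Proof. by rewrite linearDr. Qed.
Let hN (X Y : k1T) : eta X (- Y) = - eta X Y. Proof. by rewrite linearNr. Qed.
Let hZ c (X Y : k1T) : eta X (c *: Y) = c * eta X Y.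
Proof. by rewrite linearZr_LR. Qed.
Let kD (u v : Vst) : k1_part (u + v) = k1_part u + k1_part v.
Proof. by rewrite linearD. Qed.
Let kZ c (u : Vst) : k1_part (c *: u) = c *: k1_part u.
Proof. by rewrite linearZ. Qed.
Let vs0 : vsval (0 : k1T) = 0. Proof. by []. Qed.
Let b0 : beta 0 = 0 :> R. Proof. by rewrite linear0. Qed.
Let A0 : A 0 = 0. Proof. by rewrite linear0. Qed.
Let h0 X : eta 0 X = 0. Proof. by rewrite linear0l. Qed.

Lemma mu_skew x y : mu_fun x y = - mu_fun y x.
Proof.
have sk : mu_coef x y = - mu_coef y x.
  by rewrite /mu_coef [eta (k1_part x) _]eta_skew; ring.
by rewrite /mu_fun sk scaleNr opprD -vsN opprB.
Qed.

Lemma mu_alternating x : mu_fun x x = 0.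
Proof.
have /eqP := mu_skew x x; rewrite -addr_eq0 -mulr2n -scaler_nat scaler_eq0.
by rewrite pnatr_eq0 /= => /eqP.
Qed.

Lemma mu_coef_linearr x : linear_for *%R (mu_coef x).
Proof.
move=> c y z; rewrite /mu_coef 2!edD 2!edZ kD kZ bD bZ hD hZ.
move: (eta _ _) (eta _ _) (beta _ : R) (beta _ : R) (beta _ : R).
by move: (ed _ _) (ed _ _) (ed _ _) (ed _ _) (ed _ _) (ed _ _) => *; ring.
Qed.

Lemma mu_linearr x : linear (mu_fun x).
Proof.
move=> c y z; apply: ed_inj => l; rewrite /mu_fun mu_coef_linearr.
rewrite kD kZ AD AZ !(edD _ (_ *: e 1)) edZ !vsD !vsN !vsZ.
do 2!rewrite !edD !edN !edZ.
by move: (ed _ _) (ed _ _) (ed _ _) (ed _ _) (ed _ _) (ed _ _) => *; ring.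
Qed.

Lemma mu_linearl y : linear (mu_fun^~ y).
Proof.
by move=> c x z /=; rewrite (mu_skew (c *: x + z)) (mu_skew x) (mu_skew z) mu_linearr opprD scalerN.
Qed.

Lemma ed1_mu x y : (0 < n)%N -> ed 1 (mu_fun x y) = mu_coef x y.
Proof.
move=> n0; rewrite /mu_fun edD edZ ed_e ?ed1_k1 ?eqxx ?mulr1 ?addr0 //; lia.
Qed.

Lemma ed2n_mu x y : (0 < n)%N -> ed (2 * n) (mu_fun x y) = 0.
Proof.
move=> n0; rewrite /mu_fun edD edZ ed_e ?ed2n_k1; last lia.
by rewrite (_ : (2 * n == 1)%N = false) ?mulr0 ?addr0 //; lia.
Qed.

Lemma k1_part_mu x y : (0 < n)%N -> k1_part (mu_fun x y) =
  ed (2 * n) x *: A (k1_part y) - ed (2 * n) y *: A (k1_part x).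
Proof.
by move=> n0; rewrite /mu_fun kD kZ k1_part_e1 // scaler0 add0r k1_part_k1.
Qed.

Lemma mu_e2n_e1 : (0 < n)%N -> mu_fun (e (2 * n)) (e 1) = a *: e 1.
Proof.
move=> n0; rewrite /mu_fun /mu_coef k1_part_e1 // k1_part_e2n // A0 b0 h0.
rewrite !scaler0 !subr0 vs0 addr0; congr (_ *: _).
have -> : ed 1 (e (2 * n)) = 0 by rewrite ed_e; [case: eqP => //; lia | lia].
have -> : ed 1 (e 1) = 1 by rewrite ed_e ?eqxx //; lia.
have -> : ed (2 * n) (e (2 * n)) = 1 by rewrite ed_e ?eqxx //; lia.
ring.
Qed.

Lemma mu_e2n_k1 X : (0 < n)%N ->
  mu_fun (e (2 * n)) (vsval X) = (beta X : R) *: e 1 + vsval (A X).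
Proof.
move=> n0; rewrite /mu_fun /mu_coef k1_part_k1 k1_part_e2n // ed1_k1 ed2n_k1.
have -> : ed (2 * n) (e (2 * n)) = 1 by rewrite ed_e ?eqxx //; lia.
rewrite h0 b0 scale1r scale0r !subr0; congr (_ *: _ + _); ring.
Qed.

Lemma mu_k1_k1 X Y : mu_fun (vsval X) (vsval Y) = - eta X Y *: e 1.
Proof.
rewrite /mu_fun /mu_coef !k1_part_k1 !ed1_k1 !ed2n_k1 !scale0r !subr0 vs0 addr0.
by congr (_ *: _); ring.
Qed.

Lemma mu_e1_k1 (X : k1T) : (0 < n)%N -> mu_fun (e 1) (vsval X) = 0.
Proof.
move=> n0; rewrite /mu_fun /mu_coef k1_part_e1 // k1_part_k1 ed1_k1 ed2n_k1.
have -> : ed (2 * n) (e 1) = 0 by rewrite ed_e; [case: eqP => //; lia | lia].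
rewrite !scale0r h0 !subr0 vs0 addr0.
by rewrite [X in X *: _](_ : _ = 0) ?scale0r //; ring.
Qed.

Hypothesis A_eta : forall X Y, derived_form A eta X Y = a * eta X Y.

Lemma mu_mu x y z : (0 < n)%N ->
  mu_fun x (mu_fun y z) =
    (a * ed (2 * n) x * mu_coef y z
     + ed (2 * n) x * (ed (2 * n) y * beta (A (k1_part z))
                       - ed (2 * n) z * beta (A (k1_part y)))
     - (ed (2 * n) y * eta (k1_part x) (A (k1_part z))
        - ed (2 * n) z * eta (k1_part x) (A (k1_part y)))) *: e 1
    + vsval (ed (2 * n) x *: (ed (2 * n) y *: A (A (k1_part z))
                              - ed (2 * n) z *: A (A (k1_part y)))).
Proof.
move=> n0; rewrite {1}/mu_fun {1}/mu_coef ed1_mu // ed2n_mu // k1_part_mu //.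
rewrite scale0r subr0 AD AN !AZ bD bN !bZ hD hN !hZ.
congr (_ *: _ + _); ring.
Qed.

Lemma mu_jacobi x y z :
  mu_fun x (mu_fun y z) + mu_fun y (mu_fun z x) + mu_fun z (mu_fun x y) = 0.
Proof.
have [n0|n0] := posnP n.
  by apply: ed_inj => l; rewrite !ed_out // n0; lia.
have etaA X Z : eta X (A Z) = a * eta X Z + eta Z (A X).
  by rewrite -A_eta /derived_form [eta (A X) Z]eta_skew; ring.
have cyc (V : lmodType R) (r s t : R) (P Q S : V) :
    r *: (s *: P - t *: Q) + s *: (t *: S - r *: P) + t *: (r *: Q - s *: S) = 0.
  rewrite !scalerBr !scalerA [s * r]mulrC [t * r]mulrC [t * s]mulrC.
  by rewrite [X in X + _ = _]addrC !addrA !subrK subrr.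
have split3 (V : lmodType R) (u w1 w2 w3 : V) (c1 c2 c3 : R) :
    c1 + c2 + c3 = 0 -> w1 + w2 + w3 = 0 ->
    c1 *: u + w1 + (c2 *: u + w2) + (c3 *: u + w3) = 0.
  move=> c0 w0; rewrite [X in X + _ = _]addrACA [LHS]addrACA.
  by rewrite -!scalerDl c0 w0 scale0r addr0.
rewrite !mu_mu //; apply: split3; last first.
  by rewrite -[LHS]/(vsval (_ + _ + _)) cyc.
rewrite /mu_coef.
move: (k1_part x) (k1_part y) (k1_part z) => X Y Z.
rewrite [eta Z X]eta_skew (etaA X Z) (etaA Y X) (etaA Z Y).
rewrite [eta Y X]eta_skew [eta Z Y]eta_skew.
move: (eta X Y) (eta Y Z) (eta X Z) => ? ? ?.
move: (eta _ _) (eta _ _) (eta _ _) => ? ? ?.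
move: (beta (A X) : R) (beta (A Y) : R) (beta (A Z) : R) => ? ? ?.
move: (beta X : R) (beta Y : R) (beta Z : R) => ? ? ?.
move: (ed _ x) (ed _ x) (ed _ y) (ed _ y) (ed _ z) (ed _ z) => *.
ring.
Qed.

Definition mu : lieBracket Vst :=
  LieBracket mu_linearl mu_linearr mu_alternating mu_jacobi.

Definition mu_almostHermitian : almostHermitianLie Vst :=
  @AlmostHermitianLie R Vst mu Jst gst Jst_sqr gst_J.

End Standard.

Arguments mu {R n} a beta A eta A_eta.
Arguments mu_almostHermitian {R n} a beta A eta A_eta.

(* Main.v *)
(* Writing [x = p e_1 + X + q e_2n] with [X] in [k_1], so that
   [J x = - q e_1 + J X + p e_2n], the components of [N (x, y)] along [e_1],
   [e_2n] and [k_1] can be computed. They vanish under the three conditions;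
   conversely [N (e_1, X)] is [beta (J X) e_1 - beta X e_2n + [A, J] X], and
   the [e_1]-component of [N (X, Y)] is [eta (X, Y) - eta (J X, J Y)]. *)
Require Import Defs.
From mathcomp Require Import all_boot all_order all_algebra.
From mathcomp Require Import reals.
From mathcomp Require Import zify ring.

Set Implicit Arguments.
Unset Strict Implicit.
Unset Printing Implicit Defensive.

Import GRing.Theory Num.Theory.
Local Open Scope ring_scope.

Section StandardJ.
Variables (R : realFieldType) (n : nat).
Hypothesis n_gt0 : (0 < n)%N.

Notation Vst := 'rV[R]_(2 * n).
Notation Jst := (Jst R n).
Notation Jk1 := (Jk1 R n).
Notation k1T := (subvs_of (k1 R n)).

Lemma Jst_e2n : Jst (e R n (2 * n)) = - e R n 1.
Proof. by rewrite -Jst_e1 // Jst_sqr. Qed.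

(** Coordinates are inner products with basis vectors, so skewness of [Jst] moves it onto the basis
    vector. *)
Lemma ed1_Jst (x : Vst) : ed 1 (Jst x) = - ed (2 * n) x.
Proof. by rewrite -!gst_e gst_Jl Jst_e1. Qed.

Lemma ed2n_Jst (x : Vst) : ed (2 * n) (Jst x) = ed 1 x.
Proof. by rewrite -!gst_e gst_Jl Jst_e2n linearNr opprK. Qed.

(** [Jst] preserves both [k1] and the plane of [e 1] and [e (2 * n)], hence commutes with the
    projection onto [k1]. *)
Lemma k1_part_Jst (x : Vst) : k1_part (Jst x) = Jk1 (k1_part x).
Proof.
have kN (u : Vst) : k1_part (- u) = - k1_part u by rewrite linearN.
rewrite {1}(k1_partE x n_gt0) !linearD !linearZ /= Jst_e1 // Jst_e2n -Jk1E kN.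
by rewrite k1_part_e1 // k1_part_e2n // k1_part_k1 oppr0 !scaler0 add0r addr0.
Qed.

Lemma Jk1_sqr (X : k1T) : Jk1 (Jk1 X) = - X.
Proof. by apply: val_inj; rewrite /= !Jk1E Jst_sqr. Qed.

Lemma eq_ed_k1_part (x y : Vst) : ed 1 x = ed 1 y ->
  ed (2 * n) x = ed (2 * n) y -> k1_part x = k1_part y -> x = y.
Proof.
by move=> h1 h2 h3; rewrite (k1_partE x n_gt0) (k1_partE y n_gt0) h1 h2 h3.
Qed.

Variables (a : R) (beta : 'Hom(k1T, R^o)) (A : 'End(k1T)).
Variable eta : {skew_symmetric k1T}.
Hypothesis A_eta : forall X Y, derived_form A eta X Y = a * eta X Y.

Let N := nijenhuis (mu a beta A eta A_eta) Jst.

Let m := mu_fun a beta A eta.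

Lemma nijenhuis_mu x y :
  N x y = m (Jst x) (Jst y) - Jst (m (Jst x) y) - Jst (m x (Jst y)) - m x y.
Proof. by []. Qed.

(** Brackets have no [e (2 * n)] component, so the two terms headed by [Jst] drop out; the [a] terms
    of the other two brackets are equal and cancel. *)
Lemma ed1_nijenhuis x y : ed 1 (N x y) =
  ed 1 x * beta (Jk1 (k1_part y)) - ed 1 y * beta (Jk1 (k1_part x))
  - ed (2 * n) x * beta (k1_part y) + ed (2 * n) y * beta (k1_part x)
  + (eta (k1_part x) (k1_part y) - eta (Jk1 (k1_part x)) (Jk1 (k1_part y))).
Proof.
have edB l (u v : Vst) : ed l (u - v) = ed l u - ed l v by rewrite linearB.
rewrite nijenhuis_mu !edB !ed1_Jst !ed2n_mu // !ed1_mu // /mu_coef.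
rewrite !ed1_Jst !ed2n_Jst !k1_part_Jst.
(* With all these values abstracted, a polynomial identity over [R] remains. *)
move: (eta _ _) (eta _ _) (ed _ _) (ed _ _) (ed _ _) (ed _ _) => ? ? ? ? ? ?.
by move: (beta _ : R) (beta _ : R) (beta _ : R) (beta _ : R) => *; ring.
Qed.

(** Here only the two terms headed by [Jst] survive, each giving minus a value of [mu_coef]; their
    [a] terms are opposite. *)
Lemma ed2n_nijenhuis x y : ed (2 * n) (N x y) =
  - (ed 1 x * beta (k1_part y) - ed 1 y * beta (k1_part x)
     + ed (2 * n) x * beta (Jk1 (k1_part y))
     - ed (2 * n) y * beta (Jk1 (k1_part x)))
  + (eta (Jk1 (k1_part x)) (k1_part y) + eta (k1_part x) (Jk1 (k1_part y))).
Proof.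
have edB l (u v : Vst) : ed l (u - v) = ed l u - ed l v by rewrite linearB.
rewrite nijenhuis_mu !edB !ed2n_Jst !ed2n_mu // !ed1_mu // /mu_coef.
rewrite !ed1_Jst !ed2n_Jst !k1_part_Jst.
move: (eta _ _) (eta _ _) (ed _ _) (ed _ _) (ed _ _) (ed _ _) => ? ? ? ? ? ?.
by move: (beta _ : R) (beta _ : R) (beta _ : R) (beta _ : R) => *; ring.
Qed.

(** The commutator of [A] with the restriction of [Jst] to [k1]. *)
Let C : 'End(k1T) := (A \o Jk1)%VF - (Jk1 \o A)%VF.

Lemma k1_part_nijenhuis x y : k1_part (N x y) =
  ed 1 x *: C (k1_part y) - ed 1 y *: C (k1_part x)
  - Jk1 (ed (2 * n) x *: C (k1_part y) - ed (2 * n) y *: C (k1_part x)).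
Proof.
have CE X : C X = A (Jk1 X) - Jk1 (A X).
  by rewrite /C add_lfunE opp_lfunE !comp_lfunE.
have kB (u v : Vst) : k1_part (u - v) = k1_part u - k1_part v.
  by rewrite linearB.
(* [F] is the [k1] component of the bracket. *)
pose F u v := ed (2 * n) u *: A (k1_part v) - ed (2 * n) v *: A (k1_part u).
rewrite nijenhuis_mu !kB !k1_part_Jst.
transitivity (F (Jst x) (Jst y) - Jk1 (F (Jst x) y) - Jk1 (F x (Jst y)) - F x y).
  have FE u v : k1_part (m u v) = F u v by exact: k1_part_mu.
  by rewrite -(FE (Jst x) (Jst y)) -(FE (Jst x) y) -(FE x (Jst y)) -(FE x y).
rewrite /F !ed2n_Jst !k1_part_Jst !CE.
have JB X Y : Jk1 (X - Y) = Jk1 X - Jk1 Y by rewrite linearB.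
have JZ c X : Jk1 (c *: X) = c *: Jk1 X by rewrite linearZ.
move: (k1_part x) (k1_part y) => X Y.
(* Since [Jk1] squares to minus the identity, [Jk1 (C X)] becomes [Jk1 (A (Jk1 X)) + A X]. *)
rewrite !(JB, JZ) !Jk1_sqr.
move: (ed 1 x) (ed 1 y) (ed (2 * n) x) (ed (2 * n) y) => p r q s.
move: (Jk1 (A (Jk1 X))) (Jk1 (A (Jk1 Y))) => P P'.
move: (A (Jk1 X)) (A (Jk1 Y)) (Jk1 (A X)) (Jk1 (A Y)) (A X) (A Y) => Q Q' S S' T T'.
(* The vector identity is checked entry by entry in the ambient space, where [ring] applies. *)
by apply: val_inj; apply/rowP => j; rewrite /= !mxE; ring.
Qed.

End StandardJ.

Theorem proposition2p4 (R : realType) (n : nat) (n_ge2 : (2 <= n)%N)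
    (a : R) (beta : 'Hom(subvs_of (k1 R n), R^o))
    (A : 'End(subvs_of (k1 R n)))
    (eta : {skew_symmetric subvs_of (k1 R n)})
    (eta_neq0 : ~ (forall X Y : subvs_of (k1 R n), eta X Y = 0))
    (A_eta : forall X Y : subvs_of (k1 R n),
       derived_form A eta X Y = a * eta X Y) :
  is_hermitian (mu_almostHermitian a beta A eta A_eta) <->
  [/\ (A \o Jk1 R n)%VF - (Jk1 R n \o A)%VF = 0,
      beta = 0
    & type11 (Jk1 R n) eta].

Proof.
have n_gt0 : (0 < n)%N by apply: ltnW.
split=> [int | [AJ beta0 eta11] x y]; last first.
  have b0 X : beta X = 0 :> R by rewrite beta0 zero_lfunE.
  (* Type (1,1) makes [Jk1] skew for [eta], which kills the [eta] terms of the [e (2 * n)]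
     component. *)
  have etaJ X Y : eta (Jk1 R n X) Y = - eta X (Jk1 R n Y).
    by rewrite -eta11 Jk1_sqr linearNl.
  apply: (eq_ed_k1_part n_gt0); rewrite linear0.
  - by rewrite ed1_nijenhuis // !b0 eta11 !mulr0 !subrr !addr0.
  - by rewrite ed2n_nijenhuis // !b0 etaJ !mulr0 !subr0 addr0 oppr0 add0r addNr.
  - by rewrite k1_part_nijenhuis // AJ !zero_lfunE !scaler0 !subrr linear0 subr0.
have ed1_e1 : ed 1 (e R n 1) = 1 by rewrite ed_e ?eqxx //; lia.
have ed2n_e1 : ed (2 * n) (e R n 1) = 0.
  by rewrite ed_e; [case: eqP => //; lia | lia].
split=> [||X Y].
(* Pairing [e 1] with [X] in [k1] isolates the commutator in the [k1] part and, next, [- beta X] in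
   the last coordinate. *)
- apply/lfunP => X; have := congr1 (@k1_part R n) (int (e R n 1) (vsval X)).
  rewrite k1_part_nijenhuis // k1_part_k1 k1_part_e1 // ed1_k1 ed2n_k1 ed1_e1 ed2n_e1.
  by rewrite !scale0r scale1r !subr0 !linear0 addr0 zero_lfunE.
- apply/lfunP => X; have := congr1 (ed (2 * n)) (int (e R n 1) (vsval X)).
  rewrite ed2n_nijenhuis // k1_part_k1 k1_part_e1 // ed1_k1 ed2n_k1 ed1_e1 ed2n_e1.
  rewrite !linear0 !linear0l !mul0r mul1r !subr0 !addr0 => /eqP.
  by rewrite oppr_eq0 zero_lfunE => /eqP.
(* For two vectors of [k1] the [beta] terms vanish, leaving only [eta]. *)
- have := congr1 (ed 1) (int (vsval X) (vsval Y)).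
  rewrite ed1_nijenhuis // !k1_part_k1 !ed1_k1 !ed2n_k1 !mul0r linear0.
  by rewrite !subr0 !add0r => /eqP; rewrite subr_eq0 eq_sym => /eqP.
Qed.
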